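(* Let $\kappa=1$ and, for $h>0$, let $\sigma(h)\in(0,1)$ be the unique value such that $$A(\lambda)=\frac{e^{-i\pi/4}\sqrt2\,\Gamma(\frac34-\frac12 i\lambda)}{\Gamma(\frac14-\frac12 i\lambda)},\qquad \lambda=-h^{-1}-i\sigma(h),$$ is real and positive. Then as $h\to0^+$, $$\sigma(h)=2e^{-\pi/h}h^{-1}(1+O(h)),$$ and as $h\to+\infty$, $$\sigma(h)=\tfrac12-h^{-1}+O(h^{-2}).$$
   Context: The existence and uniqueness of $\sigma(h)\in(0,1)$ with $A(\lambda)$ real and positive, for each $h>0$ when $\kappa=1$, is part of the setting (it is guaranteed by a separate result). *)

(* Defs.v *)
From Stdlib Require Import Reals Factorial.
From Coquelicot Require Import Coquelicot.
Open Scope R_scope.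

Definition cexp (z : C) : C :=
  (exp (Re z) * cos (Im z), exp (Re z) * sin (Im z)).

Definition rcpow (x : R) (z : C) : C := cexp (Cmult z (RtoC (ln x))).

Definition gauss_seq (z : C) (n : nat) : C :=
  Cdiv (Cmult (rcpow (INR n) z) (RtoC (INR (Factorial.fact n))))
       (List.fold_right (fun k acc => Cmult (Cplus z (RtoC (INR k))) acc) (RtoC 1) (List.seq 0 (S n))).

(* Complex Gamma function (Gauss' limit formula, valid for z not in {0,-1,-2,...}) *)
Definition CGamma (z : C) : C :=
  (real (Lim_seq (fun n => Re (gauss_seq z n))),
   real (Lim_seq (fun n => Im (gauss_seq z n)))).

Definition Ci : C := (0, 1).

Definition A_fun (lam : C) : C :=
  Cdiv (Cmult (Cmult (cexp (Cmult (RtoC (- PI / 4)) Ci)) (RtoC (sqrt 2)))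
              (CGamma (Cminus (RtoC (3/4)) (Cmult (Cmult (RtoC (1/2)) Ci) lam))))
       (CGamma (Cminus (RtoC (1/4)) (Cmult (Cmult (RtoC (1/2)) Ci) lam))).

Definition lam_of (h s : R) : C := (- / h, - s).

(* Main.v *)
(* Put t = 1/(2h) and s = sigma/2, so that A is a positive multiple of
   e^(-i pi/4) Gamma(3/4 - s + it) / Gamma(1/4 - s + it). By Gauss' product the
   argument of the Gamma quotient is the limit Phi(s, t) of the partial sums
   [phase t s n], and 0 <= Phi < pi; hence A is real exactly when Phi = pi/4.

   As t -> 0 every term but the k = 0 one is O(t), so atan((1/4 - s)/t) = pi/4 + O(t).

   As t -> infinity, the sine product at z = 1/4 + it gives the exact value
   Phi(0, t) = arg sin(pi z) = pi/4 - atan(e^(-2 pi t)). The product is obtained from the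
   integrals W_n of cos^(2n)(x) cos(2zx) over [0, pi/2], which satisfy
   ((n+1)^2 - z^2) W_(n+1) = (n+1)(n+1/2) W_n and 2 z W_0 = sin(pi z), and whose arguments
   tend to 0. Comparing the alternating sum with half of a telescoping one,
   Phi(s, t) - Phi(0, t) = atan(s/t)/2 + O(s/t^2), and Phi = pi/4 becomes
   s/(2t) (1 + O(1/t)) = e^(-2 pi t) (1 + O(e^(-2 pi t))). *)
Require Import Defs.
From Stdlib Require Import Reals Factorial Lra Lia.
From Coquelicot Require Import Coquelicot.
Open Scope R_scope.

(** * Elementary bounds for the logarithm and arctangent, and a convergence criterion *)

Lemma ln_le_sub1 (x : R) : 0 < x -> ln x <= x - 1.
Proof.
  intros hx. pose proof (exp_ineq1_le (ln x)) as h.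
  rewrite exp_ln in h by assumption. lra.
Qed.

Lemma ln_ge_sub_inv (x : R) : 0 < x -> 1 - / x <= ln x.
Proof.
  intros hx. assert (hi : 0 < / x) by now apply Rinv_0_lt_compat.
  pose proof (ln_le_sub1 (/ x) hi) as h. rewrite ln_Rinv in h by assumption. lra.
Qed.

Lemma atan_bounds (u : R) : 0 <= u -> u - u ^ 2 <= atan u <= u.
Proof.
  intros hu.
  destruct (MVT_gen atan 0 u (fun x => / (1 + x²))) as [c [hc e]].
  - intros x _. apply is_derive_atan.
  - intros x _. apply derivable_continuous_pt, derivable_pt_atan.
  - rewrite Rmin_left, Rmax_right in hc by assumption.
    rewrite atan_0, !Rminus_0_r in e. rewrite e. unfold Rsqr.
    assert (hp : 0 < 1 + c * c) by nra.
    assert (h1 : / (1 + c * c) <= 1).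
    { rewrite <- Rinv_1. apply Rinv_le_contravar; nra. }
    assert (h2 : 1 - c <= / (1 + c * c)).
    { apply Rmult_le_reg_r with (1 + c * c); [exact hp|].
      rewrite Rinv_l by lra. nra. }
    split; nra.
Qed.

Lemma atan_le (x y : R) : x <= y -> atan x <= atan y.
Proof.
  intros [h | ->]; [left; now apply atan_increasing | right; reflexivity].
Qed.

(** Since [1/n^2] is dominated by the telescoping [2 (1/n - 1/(n+1))], the sequence [a n - 2c/n]
    increases and [a n + 2c/n] decreases from [n = 1] on. Index 0 is left free, as [ln (INR n)] and
    [/ INR n] are meaningless there. *)
Lemma ex_lim_of_increments (a : nat -> R) (c : R) :
  (forall n, (1 <= n)%nat -> Rabs (a (S n) - a n) <= c / INR n ^ 2) ->
  ex_finite_lim_seq a.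
Proof.
  intros h.
  assert (c0 : 0 <= c).
  { pose proof (h 1%nat (le_n _)) as h1. pose proof (Rabs_pos (a 2%nat - a 1%nat)).
    simpl in h1. lra. }
  assert (step : forall n, Rabs (a (S (S n)) - a (S n)) <=
                   2 * c * (/ INR (S n) - / INR (S (S n)))).
  { intros n. eapply Rle_trans; [apply h; lia|].
    rewrite (S_INR (S n)). pose proof (pos_INR n). rewrite S_INR.
    set (m := INR n + 1). assert (hm : 1 <= m) by (unfold m; lra).
    replace (2 * c * (/ m - / (m + 1))) with (c / m ^ 2 * (2 * m / (m + 1)))
      by (field; lra).
    assert (0 <= c / m ^ 2) by (apply Rdiv_le_0_compat; nra).
    assert (1 <= 2 * m / (m + 1)).
    { apply Rmult_le_reg_r with (m + 1); [lra|]. field_simplify; lra. }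
    nra. }
  assert (ip : forall n, 0 < / INR (S n)).
  { intros n. apply Rinv_0_lt_compat, lt_0_INR. lia. }
  assert (dec : forall n, a (S n) + 2 * c * / INR (S n) <= a 1%nat + 2 * c).
  { induction n as [|n IH].
    - simpl. lra.
    - pose proof (step n) as s. apply Rabs_le_between in s. lra. }
  destruct (ex_finite_lim_seq_incr (fun n => a (S n) - 2 * c * / INR (S n))
              (a 1%nat + 2 * c)) as [l hl].
  - intros n. pose proof (step n) as s. apply Rabs_le_between in s. lra.
  - intros n. pose proof (dec n). pose proof (ip n).
    assert (0 <= 2 * c * / INR (S n)) by nra. lra.
  - exists l. apply is_lim_seq_incr_1.
    apply is_lim_seq_ext with
      (fun n => (a (S n) - 2 * c * / INR (S n)) + 2 * c * / INR (S n)).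
    { intros n. lra. }
    replace l with (l + 2 * c * 0) by ring.
    apply is_lim_seq_plus'; [exact hl|].
    apply is_lim_seq_mult'; [apply is_lim_seq_const|].
    apply (is_lim_seq_incr_1 (fun n => / INR n)).
    replace (Finite 0) with (Rbar_inv p_infty) by reflexivity.
    apply is_lim_seq_inv; [apply is_lim_seq_INR | discriminate].
Qed.

(** * Polar form of the Gamma function *)

(** For [t > 0] this is the argument of [x + it] in [(0, PI)]; the form [atan (x / t)] serves every
    sign of [x] without a case split. *)
Definition arg_up (t x : R) : R := PI / 2 - atan (x / t).

Definition log_abs (t x : R) : R := ln (x ^ 2 + t ^ 2) / 2.

Lemma cexp_plus (a b : C) : cexp (Cplus a b) = Cmult (cexp a) (cexp b).
Proof.
  destruct a as [a1 a2], b as [b1 b2]. unfold cexp, Cplus, Cmult; simpl.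
  rewrite exp_plus, cos_plus, sin_plus. f_equal; ring.
Qed.

Lemma cexp_0 : cexp (0, 0) = RtoC 1.
Proof. unfold cexp, RtoC; simpl. rewrite exp_0, cos_0, sin_0. f_equal; ring. Qed.

Lemma cexp_neq_0 (z : C) : cexp z <> RtoC 0.
Proof.
  unfold cexp, RtoC. intros e. injection e as e1 e2.
  pose proof (exp_pos (Re z)) as hp. pose proof (sin2_cos2 (Im z)) as h.
  unfold Rsqr in h. apply Rmult_integral in e1, e2.
  destruct e1 as [e1|e1], e2 as [e2|e2]; try lra. rewrite e1, e2 in h. lra.
Qed.

Lemma cexp_opp (z : C) : cexp (Copp z) = Cinv (cexp z).
Proof.
  assert (h : Cmult (cexp (Copp z)) (cexp z) = RtoC 1).
  { rewrite <- cexp_plus, <- cexp_0. f_equal. destruct z.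
    unfold Cplus, Copp; simpl. f_equal; ring. }
  rewrite <- (Cmult_1_l (Cinv (cexp z))), <- h, <- Cmult_assoc, Cinv_r, Cmult_1_r.
  - reflexivity.
  - apply cexp_neq_0.
Qed.

Lemma cexp_ln (x : R) : 0 < x -> cexp (ln x, 0) = RtoC x.
Proof.
  intros hx. unfold cexp, RtoC; simpl. rewrite exp_ln, cos_0, sin_0 by assumption.
  f_equal; ring.
Qed.

Lemma cexp_polar (t x : R) : 0 < t -> cexp (log_abs t x, arg_up t x) = (x, t).
Proof.
  intros ht. unfold cexp, log_abs, arg_up; simpl.
  assert (hp : 0 < x * (x * 1) + t * (t * 1)) by nra.
  assert (er : exp (ln (x * (x * 1) + t * (t * 1)) / 2) = sqrt (x ^ 2 + t ^ 2)).
  { change (x * (x * 1) + t * (t * 1)) with (x ^ 2 + t ^ 2) in *.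
    apply Rsqr_inj; [left; apply exp_pos | apply sqrt_pos |].
    rewrite Rsqr_sqrt by lra. unfold Rsqr. rewrite <- exp_plus.
    replace (ln (x ^ 2 + t ^ 2) / 2 + ln (x ^ 2 + t ^ 2) / 2)
      with (ln (x ^ 2 + t ^ 2)) by lra.
    now apply exp_ln. }
  assert (es : sqrt (1 + (x / t)²) = sqrt (x ^ 2 + t ^ 2) / t).
  { replace (1 + (x / t)²) with ((x ^ 2 + t ^ 2) / t²)
      by (unfold Rsqr; field; lra).
    rewrite sqrt_div_alt by (apply Rlt_0_sqr; lra).
    rewrite sqrt_Rsqr by lra. reflexivity. }
  assert (hs : 0 < sqrt (x ^ 2 + t ^ 2)) by (apply sqrt_lt_R0; simpl; lra).
  rewrite er, cos_shift, sin_shift, sin_atan, cos_atan, es.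
  f_equal; field; lra.
Qed.

Lemma gauss_denominator (t x : R) (n : nat) : 0 < t ->
  List.fold_right (fun k acc => Cmult (Cplus (x, t) (RtoC (INR k))) acc)
    (RtoC 1) (List.seq 0 (S n)) =
  cexp (sum_f_R0 (fun k => log_abs t (x + INR k)) n,
        sum_f_R0 (fun k => arg_up t (x + INR k)) n).
Proof.
  intros ht.
  (* Appending an index to [seq] changes the innermost seed of the fold; [gen] pulls that seed out
     as a factor. *)
  assert (gen : forall l c,
    List.fold_right (fun k acc => Cmult (Cplus (x, t) (RtoC (INR k))) acc) c l =
    Cmult (List.fold_right (fun k acc => Cmult (Cplus (x, t) (RtoC (INR k))) acc)
             (RtoC 1) l) c).
  { induction l as [|k l IH]; intros c; cbn [List.fold_right].
    - now rewrite Cmult_1_l.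
    - rewrite IH. apply Cmult_assoc. }
  assert (fac : forall k, Cplus (x, t) (RtoC (INR k)) =
                  cexp (log_abs t (x + INR k), arg_up t (x + INR k))).
  { intros k. rewrite cexp_polar by assumption. unfold Cplus, RtoC; simpl.
    f_equal; ring. }
  induction n as [|n IH].
  - cbn [List.seq List.fold_right]. rewrite Cmult_1_r, fac. reflexivity.
  - rewrite List.seq_S, List.fold_right_app, gen, IH.
    cbn [List.fold_right]. rewrite Cmult_1_r, fac, <- cexp_plus. reflexivity.
Qed.

Lemma gauss_seq_polar (t x : R) (n : nat) : 0 < t ->
  gauss_seq (x, t) n =
  cexp (x * ln (INR n) + ln (INR (fact n)) - sum_f_R0 (fun k => log_abs t (x + INR k)) n,
        t * ln (INR n) - sum_f_R0 (fun k => arg_up t (x + INR k)) n).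
Proof.
  intros ht. unfold gauss_seq, rcpow, Cdiv.
  rewrite gauss_denominator by assumption.
  rewrite <- (cexp_ln (INR (fact n))) by apply INR_fact_lt_0.
  rewrite <- cexp_opp, <- !cexp_plus. f_equal.
  unfold Cplus, Cmult, Copp, RtoC; simpl. f_equal; ring.
Qed.

Lemma ln_succ_bounds (n : nat) : (1 <= n)%nat ->
  / (INR n + 1) <= ln (INR n + 1) - ln (INR n) <= / INR n.
Proof.
  intros hn. apply le_INR in hn. simpl in hn.
  assert (hq : 0 < (INR n + 1) / INR n) by (apply Rdiv_lt_0_compat; lra).
  rewrite <- ln_div by lra.
  pose proof (ln_le_sub1 _ hq) as h1. pose proof (ln_ge_sub_inv _ hq) as h2.
  replace ((INR n + 1) / INR n - 1) with (/ INR n) in h1 by (field; lra).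
  replace (1 - / ((INR n + 1) / INR n)) with (/ (INR n + 1)) in h2
    by (field; lra).
  lra.
Qed.

Lemma arg_up_inv (t y : R) : 0 < t -> 0 < y -> arg_up t y = atan (t / y).
Proof.
  intros ht hy. unfold arg_up. rewrite <- atan_inv.
  - f_equal. field. lra.
  - now apply Rdiv_lt_0_compat.
Qed.

Lemma inv_sub_le (a b d m : R) :
  0 < m -> m <= a -> m <= b -> 0 <= d -> b - a <= d -> / a - / b <= d / m ^ 2.
Proof.
  intros hm ha hb hd h.
  replace (/ a - / b) with ((b - a) * / (a * b)) by (field; lra).
  assert (i1 : 0 < / (a * b)) by (apply Rinv_0_lt_compat; nra).
  assert (i2 : / (a * b) <= / m ^ 2) by (apply Rinv_le_contravar; nra).
  unfold Rdiv. nra.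
Qed.

(** The logarithm grows by [t/n + O(1/n^2)] and the new argument is
    [atan (t / (x+n+1)) = t/n + O(1/n^2)], so the increments are summable. *)
Lemma gauss_arg_converges (t x : R) : 0 < t -> -1 <= x <= 1 ->
  ex_finite_lim_seq (fun n =>
    t * ln (INR n) - sum_f_R0 (fun k => arg_up t (x + INR k)) n).
Proof.
  intros ht hx. apply (ex_lim_of_increments _ (2 * t + t ^ 2)).
  intros n hn. pose proof (ln_succ_bounds n hn) as [l1 l2].
  apply le_INR in hn. simpl in hn. rewrite tech5, S_INR.
  set (N := INR n) in *.
  rewrite arg_up_inv by lra.
  set (y := x + (N + 1)) in *. assert (hy : N <= y) by (unfold y; lra).
  destruct (atan_bounds (t / y)) as [a1 a2]; [apply Rdiv_le_0_compat; lra|].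
  assert (b1 : / N - / y <= 2 / N ^ 2) by (apply inv_sub_le; unfold y; lra).
  assert (b2 : / y - / (N + 1) <= 1 / N ^ 2) by (apply inv_sub_le; unfold y; lra).
  assert (b3 : (t / y) ^ 2 <= t ^ 2 * / N ^ 2).
  { replace ((t / y) ^ 2) with (t ^ 2 * / y ^ 2) by (field; lra).
    apply Rmult_le_compat_l; [nra|]. apply Rinv_le_contravar; nra. }
  assert (hi : 0 < / N ^ 2) by (apply Rinv_0_lt_compat; nra).
  unfold Rdiv in *. apply Rabs_le.
  assert (t * / N - t * / y <= t * (2 * / N ^ 2)) by nra.
  assert (t * / y - t * / (N + 1) <= t * (1 * / N ^ 2)) by nra.
  assert (0 <= t ^ 2 * / N ^ 2) by nra.
  split; nra.
Qed.

(** The increment is [x ln((N+1)/N) - ln(w)/2] with [w = |x+N+1+it|^2/(N+1)^2 = 1 + 2x/(N+1) +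
    O(1/N^2)]; the terms of order [1/N] cancel. *)
Lemma gauss_log_abs_converges (t x : R) : 0 < t -> -1 <= x <= 1 ->
  ex_finite_lim_seq (fun n =>
    x * ln (INR n) + ln (INR (fact n))
    - sum_f_R0 (fun k => log_abs t (x + INR k)) n).
Proof.
  intros ht hx. apply (ex_lim_of_increments _ (1 + 2 * (3 + t ^ 2) ^ 2)).
  intros n hn. pose proof (ln_succ_bounds n hn) as [l1 l2].
  apply le_INR in hn. simpl in hn. rewrite tech5.
  rewrite fact_simpl, mult_INR, S_INR, ln_mult;
    [ | pose proof (pos_INR n); lra | apply INR_fact_lt_0].
  set (N := INR n) in *. unfold log_abs.
  set (w := ((x + (N + 1)) ^ 2 + t ^ 2) / (N + 1) ^ 2).
  (* From [x >= -1] and [N >= 1]. Keeping [w] away from 0 makes [1 - /w <= ln w] accurate to second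
     order in [v = w - 1]. *)
  assert (hw : / 4 <= w).
  { unfold w. apply Rmult_le_reg_r with ((N + 1) ^ 2); [nra|].
    field_simplify; [|lra]. nra. }
  assert (ew : ln ((x + (N + 1)) ^ 2 + t ^ 2) = 2 * ln (N + 1) + ln w).
  { replace ((x + (N + 1)) ^ 2 + t ^ 2) with ((N + 1) * ((N + 1) * w))
      by (unfold w; field; lra).
    clearbody w. rewrite !ln_mult by (try (apply Rmult_lt_0_compat); lra). ring. }
  rewrite ew.
  pose proof (ln_le_sub1 w ltac:(lra)) as w1.
  pose proof (ln_ge_sub_inv w ltac:(lra)) as w2.
  set (v := w - 1).
  set (i := / (N + 1)).
  assert (hi : 0 < i <= / N).
  { unfold i. split; [apply Rinv_0_lt_compat; lra | apply Rinv_le_contravar; lra]. }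
  assert (ev : v = 2 * x * i + (x ^ 2 + t ^ 2) * i ^ 2)
    by (unfold v, w, i; field; lra).
  assert (iw : 0 < / w <= 4).
  { split; [apply Rinv_0_lt_compat; lra|].
    replace 4 with (/ / 4) by lra. apply Rinv_le_contravar; lra. }
  assert (e2 : 1 - / w = v - v ^ 2 * / w) by (unfold v; field; lra).
  assert (i1 : i <= 1).
  { unfold i. rewrite <- Rinv_1. apply Rinv_le_contravar; lra. }
  assert (bv : v ^ 2 <= ((3 + t ^ 2) * i) ^ 2).
  { apply pow_maj_Rabs, Rabs_le. rewrite ev.
    assert (0 <= (x ^ 2 + t ^ 2) * i <= 1 + t ^ 2) by (split; nra).
    split; nra. }
  assert (bvw : v ^ 2 * / w <= 4 * ((3 + t ^ 2) * i) ^ 2).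
  { assert (0 <= v ^ 2) by nra. nra. }
  assert (ii : i ^ 2 <= / N ^ 2).
  { rewrite <- pow_inv by lra. nra. }
  assert (d : / N - i <= 1 / N ^ 2) by (unfold i; apply inv_sub_le; lra).
  assert (xl : Rabs (x * (ln (N + 1) - ln N) - x * i) <= / N ^ 2).
  { rewrite <- Rmult_minus_distr_l, Rabs_mult.
    assert (Rabs x <= 1) by (apply Rabs_le; lra).
    assert (Rabs (ln (N + 1) - ln N - i) <= / N ^ 2).
    { assert (0 < / N ^ 2) by (apply Rinv_0_lt_compat; nra).
      apply Rabs_le. unfold i in *; lra. }
    pose proof (Rabs_pos x). pose proof (Rabs_pos (ln (N + 1) - ln N - i)).
    nra. }
  apply Rabs_le_between in xl.
  assert (bb : ((3 + t ^ 2) * i) ^ 2 <= (3 + t ^ 2) ^ 2 * / N ^ 2).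
  { rewrite Rpow_mult_distr. apply Rmult_le_compat_l; [apply pow2_ge_0 | exact ii]. }
  assert (bc : (x ^ 2 + t ^ 2) * i ^ 2 <= ((3 + t ^ 2) * i) ^ 2).
  { rewrite Rpow_mult_distr. apply Rmult_le_compat_r; nra. }
  assert (fold_v : w - 1 = v) by reflexivity.
  unfold Rdiv. apply Rabs_le. nra.
Qed.

(** Modulus and argument converge separately, so the [Lim_seq] values in [CGamma] are genuine finite
    limits. The angle [theta] is the unreduced limit, not one taken modulo [2 PI], which lets two
    such angles be subtracted. *)
Lemma CGamma_polar (t x : R) : 0 < t -> -1 <= x <= 1 ->
  exists L theta : R, CGamma (x, t) = cexp (L, theta) /\
    is_lim_seq (fun n =>
      t * ln (INR n) - sum_f_R0 (fun k => arg_up t (x + INR k)) n) theta.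
Proof.
  intros ht hx.
  destruct (gauss_log_abs_converges t x ht hx) as [L hL].
  destruct (gauss_arg_converges t x ht hx) as [theta hth].
  exists L, theta. split; [|exact hth].
  assert (hE := is_lim_seq_continuous exp _ _
           (derivable_continuous_pt _ _ (derivable_pt_exp L)) hL).
  assert (hC := is_lim_seq_continuous cos _ _
           (derivable_continuous_pt _ _ (derivable_pt_cos theta)) hth).
  assert (hS := is_lim_seq_continuous sin _ _
           (derivable_continuous_pt _ _ (derivable_pt_sin theta)) hth).
  assert (eR : Lim_seq (fun n => Re (gauss_seq (x, t) n)) = exp L * cos theta).
  { apply is_lim_seq_unique.
    eapply is_lim_seq_ext; [|exact (is_lim_seq_mult' _ _ _ _ hE hC)].
    intros n. rewrite gauss_seq_polar by assumption. reflexivity. }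
  assert (eI : Lim_seq (fun n => Im (gauss_seq (x, t) n)) = exp L * sin theta).
  { apply is_lim_seq_unique.
    eapply is_lim_seq_ext; [|exact (is_lim_seq_mult' _ _ _ _ hE hS)].
    intros n. rewrite gauss_seq_polar by assumption. reflexivity. }
  unfold CGamma. rewrite eR, eI. reflexivity.
Qed.

(** * The phase of the Gamma quotient *)

(** The difference of the Gauss arguments at [3/4 - s + it] and [1/4 - s + it]: the terms [t ln n]
    and the constants [PI / 2] cancel. *)
Definition phase (t s : R) (n : nat) : R :=
  sum_f_R0 (fun k => atan ((3 / 4 - s + INR k) / t) - atan ((1 / 4 - s + INR k) / t)) n.

Lemma atan_div_le (t x y : R) : 0 < t -> x <= y -> atan (x / t) <= atan (y / t).
Proof.
  intros ht h. apply atan_le. apply Rmult_le_compat_r; [|exact h].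
  left. now apply Rinv_0_lt_compat.
Qed.

Lemma phase_incr (t s : R) (n : nat) : 0 < t -> phase t s n <= phase t s (S n).
Proof.
  intros ht. unfold phase. rewrite tech5.
  pose proof (atan_div_le t (1 / 4 - s + INR (S n)) (3 / 4 - s + INR (S n)) ht). lra.
Qed.

Lemma phase_lb (t s : R) (n : nat) : 0 < t ->
  atan ((3 / 4 - s) / t) - atan ((1 / 4 - s) / t) <= phase t s n.
Proof.
  intros ht. induction n as [|n IH].
  - unfold phase; simpl. rewrite !Rplus_0_r. lra.
  - pose proof (phase_incr t s n ht). lra.
Qed.

(** For [k >= 1], raising [3/4 - s + k] to [5/4 - s + k], the lower point of the next term, makes
    the sum telescope from [5/4 - s]; its end is below [PI / 2]. *)
Lemma phase_ub (t s : R) (n : nat) : 0 < t ->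
  phase t s n <= atan ((3 / 4 - s) / t) - atan ((1 / 4 - s) / t) + arg_up t (5 / 4 - s).
Proof.
  intros ht.
  assert (h : phase t s n <= atan ((3 / 4 - s) / t) - atan ((1 / 4 - s) / t)
              + (atan ((5 / 4 - s + INR n) / t) - atan ((5 / 4 - s) / t))).
  { induction n as [|n IH].
    - unfold phase; simpl. rewrite !Rplus_0_r. lra.
    - unfold phase in *. rewrite tech5, S_INR in *.
      replace (1 / 4 - s + (INR n + 1)) with (5 / 4 - s + INR n) by lra.
      pose proof (atan_div_le t (3 / 4 - s + (INR n + 1))
                    (5 / 4 - s + (INR n + 1)) ht). lra. }
  pose proof (atan_bound ((5 / 4 - s + INR n) / t)). unfold arg_up. lra.
Qed.

Lemma phase_range (t s : R) (n : nat) : 0 < t ->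
  0 <= phase t s n <= arg_up t (1 / 4 - s).
Proof.
  intros ht. pose proof (phase_lb t s n ht). pose proof (phase_ub t s n ht).
  pose proof (atan_div_le t (1 / 4 - s) (3 / 4 - s) ht ltac:(lra)).
  pose proof (atan_div_le t (3 / 4 - s) (5 / 4 - s) ht ltac:(lra)).
  unfold arg_up in *. lra.
Qed.

Lemma phase_converges (t s : R) : 0 < t -> ex_finite_lim_seq (phase t s).
Proof.
  intros ht. apply (ex_finite_lim_seq_incr _ (arg_up t (1 / 4 - s))); intros n.
  - now apply phase_incr.
  - now apply phase_range.
Qed.

Lemma is_lim_seq_bounds (u : nat -> R) (l a b : R) :
  (forall n, a <= u n <= b) -> is_lim_seq u l -> a <= l <= b.
Proof.
  intros h hl. split.
  - apply (is_lim_seq_le (fun _ => a) u a l); [apply h | apply is_lim_seq_const | exact hl].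
  - apply (is_lim_seq_le u (fun _ => b) l b); [apply h | exact hl | apply is_lim_seq_const].
Qed.

(** Confines the phase to an interval of length [PI], so that a vanishing sine determines it. *)
Lemma phase_lim_range (t s l : R) : 0 < t -> is_lim_seq (phase t s) l -> 0 <= l < PI.
Proof.
  intros ht hl.
  pose proof (is_lim_seq_bounds _ _ _ _ (fun n => phase_range t s n ht) hl).
  pose proof (atan_bound ((1 / 4 - s) / t)). unfold arg_up in *. lra.
Qed.

Lemma sin_eq_0_small (d : R) : - PI < d < PI -> sin d = 0 -> d = 0.
Proof.
  intros [h1 h2] e. destruct (Rtotal_order d 0) as [h|[h|h]]; [|exact h|].
  - pose proof (sin_lt_0_var d h1 h). lra.
  - pose proof (sin_gt_0 d h h2). lra.
Qed.

(** [A] is a positive number times [e^(i (Phi - PI/4))], so a zero imaginary part gives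
    [sin (Phi - PI/4) = 0]. As [Phi - PI/4] lies in [[-PI/4, 3 PI/4)], it is 0. *)
Lemma phase_of_real_A (h sig : R) :
  0 < h -> 0 < sig < 1 -> Im (A_fun (lam_of h sig)) = 0 ->
  is_lim_seq (phase (/ (2 * h)) (sig / 2)) (PI / 4).
Proof.
  intros hh hs hA. set (t := / (2 * h)). set (s := sig / 2).
  assert (ht : 0 < t) by (apply Rinv_0_lt_compat; lra).
  assert (hs' : 0 < s < 1 / 2) by (unfold s; lra).
  assert (eta : forall c, Cminus (RtoC c) (Cmult (Cmult (RtoC (1 / 2)) Ci) (lam_of h sig))
                = (c - s, t)).
  { intros c. unfold Cminus, Cplus, Copp, Cmult, Ci, lam_of, RtoC, s, t; simpl.
    f_equal; field; lra. }
  destruct (CGamma_polar t (3 / 4 - s) ht ltac:(lra)) as [L1 [th1 [e1 l1]]].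
  destruct (CGamma_polar t (1 / 4 - s) ht ltac:(lra)) as [L2 [th2 [e2 l2]]].
  assert (lp : is_lim_seq (phase t s) (th1 - th2)).
  { eapply is_lim_seq_ext; [|exact (is_lim_seq_minus' _ _ _ _ l1 l2)].
    intros n. cbv beta. unfold phase.
    induction n as [|n IH].
    - simpl. unfold arg_up. ring.
    - rewrite !tech5, <- IH. unfold arg_up. ring. }
  replace (PI / 4) with (th1 - th2); [exact lp|].
  pose proof (phase_lim_range t s _ ht lp) as [r1 r2].
  assert (hd : th1 - th2 - PI / 4 = 0); [|lra].
  pose proof PI_RGT_0.
  apply sin_eq_0_small; [lra|].
  unfold A_fun in hA. rewrite !eta, e1, e2 in hA.
  rewrite <- (cexp_ln (sqrt 2)) in hA by (apply sqrt_lt_R0; lra).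
  unfold Cdiv in hA. rewrite <- cexp_opp, <- !cexp_plus in hA.
  unfold cexp, Cplus, Cmult, Copp, RtoC, Ci in hA. simpl in hA.
  apply Rmult_integral in hA. destruct hA as [hA|hA].
  - match type of hA with exp ?y = 0 => pose proof (exp_pos y) end. lra.
  - rewrite <- hA. f_equal. lra.
Qed.

(** * Asymptotics for large h *)

Lemma tan_near_PI4 (a t : R) : 0 < t <= / 100 -> Rabs (a - PI / 4) <= 4 * t ->
  Rabs (tan a - 1) <= 32 * t.
Proof.
  intros ht ha. set (d := a - PI / 4) in *.
  assert (hsd : Rabs (sin d) <= Rabs d).
  { destruct (Rtotal_order d 0) as [h|[h|h]].
    - pose proof (sin_lt_x (- d) ltac:(lra)) as h1. rewrite sin_neg in h1.
      rewrite (Rabs_left d) by lra.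
      assert (sin d < 0).
      { apply Rabs_le_between in ha. pose proof PI2_1.
        apply sin_lt_0_var; lra. }
      rewrite Rabs_left by lra. lra.
    - rewrite h, sin_0. lra.
    - pose proof (sin_lt_x d h).
      rewrite (Rabs_pos_eq d) by lra.
      apply Rabs_le_between in ha. pose proof PI2_1.
      rewrite Rabs_pos_eq by (apply sin_ge_0; lra). lra. }
  assert (hs : Rabs (sin d) <= 4 * t) by lra.
  assert (hc : 0 < cos d).
  { apply Rabs_le_between in ha. pose proof PI2_1. apply cos_gt_0; lra. }
  pose proof (sin2_cos2 d) as e. unfold Rsqr in e.
  pose proof hs as hs'. apply Rabs_le_between in hs'.
  assert (hc' : 9 / 10 <= cos d) by nra.
  assert (hden : 1 / 2 <= cos d - sin d) by lra.
  assert (sq : 0 < sqrt 2) by (apply sqrt_lt_R0; lra).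
  (* Addition formulas at [PI/4 + d]; the common factor [sqrt 2 / 2] cancels. *)
  assert (et : tan a - 1 = 2 * sin d * / (cos d - sin d)).
  { unfold tan. replace a with (PI / 4 + d) by (unfold d; ring).
    rewrite sin_plus, cos_plus, sin_PI4, cos_PI4. field. split; [lra|].
    lra. }
  rewrite et, !Rabs_mult, (Rabs_pos_eq 2), (Rabs_pos_eq (/ _)) by
    (try (left; apply Rinv_0_lt_compat); lra).
  assert (0 < / (cos d - sin d) <= 2).
  { split; [apply Rinv_0_lt_compat; lra|].
    replace 2 with (/ (1 / 2)) by lra. apply Rinv_le_contravar; lra. }
  pose proof (Rabs_pos (sin d)). nra.
Qed.

(** The bounds on the phase isolate the [k = 0] term and give [atan ((1/4 - s) / t) = PI/4 + O(t)].
    Taking tangents, [s = 1/4 - t + O(t^2)]. *)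
Lemma large_h (h sig : R) :
  50 <= h -> 0 < sig < 1 -> is_lim_seq (phase (/ (2 * h)) (sig / 2)) (PI / 4) ->
  Rabs (sig - (1 / 2 - / h)) <= 16 / h ^ 2.
Proof.
  intros hh hs hl. set (t := / (2 * h)) in *. set (s := sig / 2) in *.
  assert (ht : 0 < t <= / 100).
  { unfold t. split; [apply Rinv_0_lt_compat; lra | apply Rinv_le_contravar; lra]. }
  assert (hs' : 0 < s < 1 / 2) by (unfold s; lra).
  pose proof (is_lim_seq_bounds _ _ _ _
    (fun n => conj (phase_lb t s n (proj1 ht)) (phase_ub t s n (proj1 ht))) hl) as hb.
  (* Points at distance at least [1/c] to the right of 0 have argument at most [c t]. It is used at
     [5/4 - s > 3/4] and [3/4 - s > 1/4]. *)
  assert (small : forall y c, 0 < c -> / c <= y -> 0 <= arg_up t y <= c * t).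
  { intros y c hc hy. assert (0 < / c) by now apply Rinv_0_lt_compat.
    rewrite arg_up_inv by lra.
    assert (i : 0 < / y <= c).
    { split; [apply Rinv_0_lt_compat; lra|].
      rewrite <- (Rinv_inv c). apply Rinv_le_contravar; lra. }
    assert (0 <= t / y <= c * t) by (unfold Rdiv; nra).
    split.
    - rewrite <- atan_0. apply atan_le. lra.
    - destruct (atan_bounds (t / y)); lra. }
  pose proof (small (5 / 4 - s) (4 / 3) ltac:(lra) ltac:(lra)) as b1.
  pose proof (small (3 / 4 - s) 4 ltac:(lra) ltac:(lra)) as b2.
  unfold arg_up at 1 2 in b2.
  assert (ha : Rabs (atan ((1 / 4 - s) / t) - PI / 4) <= 4 * t) by (apply Rabs_le; lra).
  pose proof (tan_near_PI4 _ t ht ha) as hT. rewrite tan_atan in hT.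
  replace ((1 / 4 - s) / t - 1) with ((1 / 4 - s - t) * / t) in hT by (field; lra).
  rewrite Rabs_mult, (Rabs_pos_eq (/ t)) in hT
    by (left; apply Rinv_0_lt_compat; lra).
  assert (hT2 : Rabs (1 / 4 - s - t) <= 32 * t * t).
  { apply Rmult_le_reg_r with (/ t); [apply Rinv_0_lt_compat; lra|].
    replace (32 * t * t * / t) with (32 * t) by (field; lra). exact hT. }
  replace (sig - (1 / 2 - / h)) with (- (2 * (1 / 4 - s - t)))
    by (unfold s, t; field; lra).
  rewrite Rabs_Ropp, Rabs_mult, (Rabs_pos_eq 2) by lra.
  replace (16 / h ^ 2) with (2 * (32 * t * t)) by (unfold t; field; lra). lra.
Qed.

(** * The sine product at 1/4 + it *)

Lemma cexp_div (a b w : C) : Cmult (cexp a) w = cexp b -> w = cexp (Cminus b a).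
Proof.
  intros e. unfold Cminus. rewrite cexp_plus, cexp_opp, <- e.
  rewrite (Cmult_comm (cexp a) w), <- Cmult_assoc, Cinv_r, Cmult_1_r.
  - reflexivity.
  - apply cexp_neq_0.
Qed.

Lemma cexp_polar_conj (t x : R) : 0 < t -> (x, - t) = cexp (log_abs t x, - arg_up t x).
Proof.
  intros ht. pose proof (cexp_polar t x ht) as e. unfold cexp in *. simpl in *.
  rewrite cos_neg, sin_neg. injection e as e1 e2. f_equal; lra.
Qed.

Definition wallis (n : nat) (f : R -> R) : R :=
  RInt (fun x => cos x ^ n * f x) 0 (PI / 2).

Lemma continuous_cos_pow_mult (n : nat) (f : R -> R) (x : R) :
  continuous f x -> continuous (fun y => cos y ^ n * f y) x.
Proof.
  intros hf. apply (continuous_mult (fun y => cos y ^ n) f); [|exact hf].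
  apply (ex_derive_continuous (fun y => cos y ^ n)). auto_derive. exact I.
Qed.

Lemma is_RInt_wallis (n : nat) (f : R -> R) : (forall x, continuous f x) ->
  is_RInt (fun x => cos x ^ n * f x) 0 (PI / 2) (wallis n f).
Proof.
  intros hf. apply (RInt_correct (fun x => cos x ^ n * f x)).
  apply (ex_RInt_continuous (fun x => cos x ^ n * f x)).
  intros x _. now apply continuous_cos_pow_mult.
Qed.

(* Two integrations by parts. *)
Lemma wallis_recurrence (u du w : R -> R) (a b : R) (n : nat) :
  (forall x, is_derive u x (du x)) ->
  (forall x, is_derive du x (a * u x + b * w x)) ->
  (forall x, continuous w x) -> du 0 = 0 ->
  (a + INR (n + 2) ^ 2) * wallis (n + 2) u + b * wallis (n + 2) w =
  INR (n + 2) * INR (n + 1) * wallis n u.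
Proof.
  intros hu hdu hw h0.
  assert (cu : forall x, continuous u x).
  { intros x. apply (ex_derive_continuous u). now exists (du x). }
  set (N := INR (n + 2)).
  assert (eN : INR (n + 1) = N - 1) by (unfold N; rewrite !plus_INR; simpl; lra).
  (* [F] collects the boundary terms of both integrations by parts. It vanishes at [PI / 2] through
     the cosine powers and at 0 through [sin 0] and [du 0]. *)
  set (F := fun x => cos x ^ (n + 2) * du x + N * (cos x ^ (n + 1) * sin x * u x)).
  set (dF := fun x => (a + N ^ 2) * (cos x ^ (n + 2) * u x)
               + b * (cos x ^ (n + 2) * w x) - N * (N - 1) * (cos x ^ n * u x)).
  assert (hF : is_RInt dF 0 (PI / 2) (minus (F (PI / 2)) (F 0))).
  { apply (is_RInt_derive F dF).
    - intros x _. unfold F.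
      evar_last.
      { apply (is_derive_plus (fun x => cos x ^ (n + 2) * du x)
                 (fun x => N * (cos x ^ (n + 1) * sin x * u x))).
        - apply (is_derive_mult (fun x => cos x ^ (n + 2)) du);
            [|apply hdu|intros; apply Rmult_comm].
          auto_derive; [exact I | reflexivity].
        - apply (is_derive_scal (fun x => cos x ^ (n + 1) * sin x * u x)).
          apply (is_derive_mult (fun x => cos x ^ (n + 1) * sin x) u);
            [|apply hu|intros; apply Rmult_comm].
          auto_derive; [exact I | reflexivity]. }
      unfold plus, mult; simpl. unfold scal, mult; simpl. unfold dF.
      fold N. rewrite eN.
      replace (Nat.pred (n + 2)) with (S n) by lia.
      replace (Nat.pred (n + 1)) with n by lia.
      replace (n + 2)%nat with (S (S n)) by lia.
      replace (n + 1)%nat with (S n) by lia. simpl.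
      pose proof (sin2_cos2 x) as e. unfold Rsqr in e.
      assert (e' : sin x * sin x = 1 - cos x * cos x) by lra.
      transitivity (cos x * (cos x * cos x ^ n) * (a * u x + b * w x)
        + N * ((cos x * cos x ^ n) * cos x
               - (N - 1) * cos x ^ n * (sin x * sin x)) * u x).
      + ring.
      + rewrite e'. ring.
    - intros x _. unfold dF.
      apply (continuous_minus (fun x => (a + N ^ 2) * (cos x ^ (n + 2) * u x)
               + b * (cos x ^ (n + 2) * w x)) (fun x => N * (N - 1) * (cos x ^ n * u x))).
      + apply (continuous_plus (fun x => (a + N ^ 2) * (cos x ^ (n + 2) * u x))
                 (fun x => b * (cos x ^ (n + 2) * w x))).
        * apply (continuous_scal_r (a + N ^ 2) (fun x => cos x ^ (n + 2) * u x)).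
          now apply continuous_cos_pow_mult.
        * apply (continuous_scal_r b (fun x => cos x ^ (n + 2) * w x)).
          now apply continuous_cos_pow_mult.
      + apply (continuous_scal_r (N * (N - 1)) (fun x => cos x ^ n * u x)).
        now apply continuous_cos_pow_mult. }
  assert (z : minus (F (PI / 2)) (F 0) = 0).
  { unfold minus, plus, opp; simpl. unfold F. rewrite cos_PI2, sin_0, h0.
    rewrite !pow_i by lia. ring. }
  rewrite z in hF.
  assert (hG : is_RInt dF 0 (PI / 2)
    (((a + N ^ 2) * wallis (n + 2) u + b * wallis (n + 2) w)
     - N * (N - 1) * wallis n u)).
  { apply (is_RInt_minus (fun x => (a + N ^ 2) * (cos x ^ (n + 2) * u x)
               + b * (cos x ^ (n + 2) * w x)) (fun x => N * (N - 1) * (cos x ^ n * u x))).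
    - apply (is_RInt_plus (fun x => (a + N ^ 2) * (cos x ^ (n + 2) * u x))
               (fun x => b * (cos x ^ (n + 2) * w x))).
      + apply (is_RInt_scal (fun x => cos x ^ (n + 2) * u x)). now apply is_RInt_wallis.
      + apply (is_RInt_scal (fun x => cos x ^ (n + 2) * w x)). now apply is_RInt_wallis.
    - apply (is_RInt_scal (fun x => cos x ^ n * u x)). now apply is_RInt_wallis. }
  rewrite eN.
  pose proof (is_RInt_unique _ _ _ _ hF). pose proof (is_RInt_unique _ _ _ _ hG).
  lra.
Qed.

Section QuarterProduct.

Variable t : R.
Hypothesis ht : 0 < t.

(* [cos (2 z x) = cu x - i * cv x] for [z = 1/4 + i t]. *)
Let cu (x : R) := cos (x / 2) * cosh (2 * t * x).
Let cv (x : R) := sin (x / 2) * sinh (2 * t * x).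
Let dcu (x : R) := - sin (x / 2) / 2 * cosh (2 * t * x) + 2 * t * cos (x / 2) * sinh (2 * t * x).
Let dcv (x : R) := cos (x / 2) / 2 * sinh (2 * t * x) + 2 * t * sin (x / 2) * cosh (2 * t * x).

Lemma is_derive_cu x : is_derive cu x (dcu x).
Proof. unfold cu, dcu. unfold cosh, sinh. auto_derive; [exact I|]. unfold Rdiv. ring. Qed.

Lemma is_derive_cv x : is_derive cv x (dcv x).
Proof. unfold cv, dcv. unfold cosh, sinh. auto_derive; [exact I|]. unfold Rdiv. ring. Qed.

(** With [is_derive_dcv], these are the real and imaginary parts of [f'' = -4 z^2 f] for
    [f = cos (2 z x)], where [-4 z^2 = 4 t^2 - 1/4 - 2 i t]. *)
Lemma is_derive_dcu x :
  is_derive dcu x ((4 * t ^ 2 - 1 / 4) * cu x + (- (2 * t)) * cv x).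
Proof.
  unfold cu, cv, dcu. unfold cosh, sinh. auto_derive; [exact I|]. unfold Rdiv. field.
Qed.

Lemma is_derive_dcv x :
  is_derive dcv x ((4 * t ^ 2 - 1 / 4) * cv x + (2 * t) * cu x).
Proof.
  unfold cu, cv, dcv. unfold cosh, sinh. auto_derive; [exact I|]. unfold Rdiv. field.
Qed.

Lemma continuous_cu x : continuous cu x.
Proof. apply (ex_derive_continuous cu). exists (dcu x). apply is_derive_cu. Qed.

Lemma continuous_cv x : continuous cv x.
Proof. apply (ex_derive_continuous cv). exists (dcv x). apply is_derive_cv. Qed.

Let W (n : nat) : C := (wallis (2 * n) cu, - wallis (2 * n) cv).


(** The recurrence with [(n+1)^2 - z^2] factored as [(n+1-z)(n+1+z)], whose arguments are those that
    enter the phase at [s = 0]; the right-hand factor is positive and carries none. *)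
Lemma W_step (n : nat) :
  Cmult (Cmult (3 / 4 + INR n, - t) (5 / 4 + INR n, t)) (W (S n)) =
  Cmult (RtoC ((INR n + 1) * (INR n + 1 / 2))) (W n).
Proof.
  assert (r1 := wallis_recurrence cu dcu cv _ _ (2 * n) is_derive_cu is_derive_dcu continuous_cv).
  assert (r2 := wallis_recurrence cv dcv cu _ _ (2 * n) is_derive_cv is_derive_dcv continuous_cu).
  assert (d1 : dcu 0 = 0).
  { unfold dcu. rewrite Rmult_0_r, sinh_0. unfold Rdiv. rewrite Rmult_0_l, sin_0. ring. }
  assert (d2 : dcv 0 = 0).
  { unfold dcv. rewrite Rmult_0_r, sinh_0. unfold Rdiv. rewrite Rmult_0_l, sin_0. ring. }
  specialize (r1 d1). specialize (r2 d2).
  rewrite !plus_INR, mult_INR in r1, r2. simpl INR in r1, r2.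
  unfold W. replace (2 * S n)%nat with (2 * n + 2)%nat by lia.
  set (U' := wallis (2 * n + 2) cu) in *. set (V' := wallis (2 * n + 2) cv) in *.
  set (U := wallis (2 * n) cu) in *. set (V := wallis (2 * n) cv) in *.
  clearbody U' V' U V. unfold Cmult, RtoC; simpl.
  f_equal; lra.
Qed.

(** This is [z W_0 = sin (PI z) / 2]; [e1] and [e2] integrate the derivatives of the real and
    imaginary parts of [sin (2 z x) / 2]. *)
Lemma W_base :
  Cmult (1 / 4, t) (W 0) = (sqrt 2 / 4 * cosh (PI * t), sqrt 2 / 4 * sinh (PI * t)).
Proof.
  assert (sq : 0 < sqrt 2) by (apply sqrt_lt_R0; lra).
  assert (s2 : sqrt 2 * sqrt 2 = 2) by (apply sqrt_sqrt; lra).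
  assert (half : / sqrt 2 = sqrt 2 / 2).
  { apply Rmult_eq_reg_l with (sqrt 2); [|lra]. rewrite Rinv_r by lra. lra. }
  assert (e1 : 1 / 4 * wallis 0 cu + t * wallis 0 cv = sqrt 2 / 4 * cosh (PI * t)).
  { assert (h : is_RInt (fun x => 1 / 4 * (cos x ^ 0 * cu x) + t * (cos x ^ 0 * cv x)) 0 (PI / 2)
        (minus (sin ((PI / 2) / 2) * cosh (2 * t * (PI / 2)) / 2)
               (sin (0 / 2) * cosh (2 * t * 0) / 2))).
    { apply (is_RInt_derive (fun x => sin (x / 2) * cosh (2 * t * x) / 2)
               (fun x => 1 / 4 * (cos x ^ 0 * cu x) + t * (cos x ^ 0 * cv x))).
      - intros x _. unfold cu, cv, cosh, sinh. auto_derive; [exact I|]. unfold Rdiv. field.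
      - intros x _. apply (continuous_plus (fun x => 1 / 4 * (cos x ^ 0 * cu x))
                             (fun x => t * (cos x ^ 0 * cv x))).
        + apply (continuous_scal_r (1 / 4) (fun x => cos x ^ 0 * cu x)).
          apply continuous_cos_pow_mult, continuous_cu.
        + apply (continuous_scal_r t (fun x => cos x ^ 0 * cv x)).
          apply continuous_cos_pow_mult, continuous_cv. }
    assert (h' : is_RInt (fun x => 1 / 4 * (cos x ^ 0 * cu x) + t * (cos x ^ 0 * cv x)) 0 (PI / 2)
       (1 / 4 * wallis 0 cu + t * wallis 0 cv)).
    { apply (is_RInt_plus (fun x => 1 / 4 * (cos x ^ 0 * cu x))
                             (fun x => t * (cos x ^ 0 * cv x))).
      - apply (is_RInt_scal (fun x => cos x ^ 0 * cu x)), is_RInt_wallis, continuous_cu.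
      - apply (is_RInt_scal (fun x => cos x ^ 0 * cv x)), is_RInt_wallis, continuous_cv. }
    pose proof (is_RInt_unique _ _ _ _ h) as q. rewrite (is_RInt_unique _ _ _ _ h') in q.
    unfold minus, plus, opp in q; simpl in q.
    replace (PI / 2 / 2) with (PI / 4) in q by field. rewrite sin_PI4 in q.
    replace (2 * t * (PI / 2)) with (PI * t) in q by field.
    replace (0 / 2) with 0 in q by field. rewrite sin_0 in q. rewrite q.
    unfold Rdiv. rewrite half. field. }
  assert (e2 : t * wallis 0 cu - 1 / 4 * wallis 0 cv = sqrt 2 / 4 * sinh (PI * t)).
  { assert (h : is_RInt (fun x => t * (cos x ^ 0 * cu x) - 1 / 4 * (cos x ^ 0 * cv x)) 0 (PI / 2)
        (minus (cos ((PI / 2) / 2) * sinh (2 * t * (PI / 2)) / 2)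
               (cos (0 / 2) * sinh (2 * t * 0) / 2))).
    { apply (is_RInt_derive (fun x => cos (x / 2) * sinh (2 * t * x) / 2)
               (fun x => t * (cos x ^ 0 * cu x) - 1 / 4 * (cos x ^ 0 * cv x))).
      - intros x _. unfold cu, cv, cosh, sinh. auto_derive; [exact I|]. unfold Rdiv. field.
      - intros x _. apply (continuous_minus (fun x => t * (cos x ^ 0 * cu x))
                             (fun x => 1 / 4 * (cos x ^ 0 * cv x))).
        + apply (continuous_scal_r t (fun x => cos x ^ 0 * cu x)).
          apply continuous_cos_pow_mult, continuous_cu.
        + apply (continuous_scal_r (1 / 4) (fun x => cos x ^ 0 * cv x)).
          apply continuous_cos_pow_mult, continuous_cv. }
    assert (h' : is_RInt (fun x => t * (cos x ^ 0 * cu x) - 1 / 4 * (cos x ^ 0 * cv x)) 0 (PI / 2)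
       (t * wallis 0 cu - 1 / 4 * wallis 0 cv)).
    { apply (is_RInt_minus (fun x => t * (cos x ^ 0 * cu x))
                             (fun x => 1 / 4 * (cos x ^ 0 * cv x))).
      - apply (is_RInt_scal (fun x => cos x ^ 0 * cu x)), is_RInt_wallis, continuous_cu.
      - apply (is_RInt_scal (fun x => cos x ^ 0 * cv x)), is_RInt_wallis, continuous_cv. }
    pose proof (is_RInt_unique _ _ _ _ h) as q. rewrite (is_RInt_unique _ _ _ _ h') in q.
    unfold minus, plus, opp in q; simpl in q.
    replace (PI / 2 / 2) with (PI / 4) in q by field. rewrite cos_PI4 in q.
    replace (2 * t * (PI / 2)) with (PI * t) in q by field.
    rewrite Rmult_0_r, sinh_0 in q. rewrite q.
    unfold Rdiv. rewrite half. field. }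
  unfold W, Cmult; simpl fst; simpl snd. rewrite <- e1, <- e2.
  f_equal; simpl; ring.
Qed.

Let alpha := PI / 4 - atan (exp (- (2 * PI * t))).

(** With [q = e^(-2 PI t)], the slope is [tanh (PI t) = (1 - q)/(1 + q) = tan (PI/4 - atan q)]. *)
Lemma cosh_sinh_polar : exists r,
  (sqrt 2 / 4 * cosh (PI * t), sqrt 2 / 4 * sinh (PI * t)) = cexp (r, alpha).
Proof.
  set (q := exp (- (2 * PI * t))). set (E := exp (PI * t)).
  assert (hq : 0 < q) by apply exp_pos. assert (hE : 0 < E) by apply exp_pos.
  assert (eE : exp (- (PI * t)) = E * q).
  { unfold E, q. rewrite <- exp_plus. f_equal. ring. }
  assert (sq : 0 < sqrt 2) by (apply sqrt_lt_R0; lra).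
  assert (s2 : sqrt 2 * sqrt 2 = 2) by (apply sqrt_sqrt; lra).
  assert (half : / sqrt 2 = sqrt 2 / 2).
  { apply Rmult_eq_reg_l with (sqrt 2); [|lra]. rewrite Rinv_r by lra. lra. }
  assert (hr : 0 < sqrt (1 + q²)).
  { apply sqrt_lt_R0. pose proof (Rle_0_sqr q). lra. }
  exists (ln (E * sqrt (1 + q²) / 4)).
  unfold cexp, alpha; simpl. fold q. rewrite exp_ln by nra.
  rewrite cos_minus, sin_minus, cos_PI4, sin_PI4, cos_atan, sin_atan.
  unfold cosh, sinh. rewrite eE. fold E. unfold Rdiv. rewrite half.
  f_equal; field; lra.
Qed.

(** Going from [W n] to [W (S n)] adds [arg_up t (3/4 + n) - arg_up t (5/4 + n)] to the argument.
    The phase pairs these values one place off, leaving one unpaired [arg_up]. *)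
Lemma W_polar (n : nat) : exists r,
  W n = cexp (r, alpha - phase t 0 n - arg_up t (3 / 4 + INR n)).
Proof.
  induction n as [|n [r IH]].
  - destruct cosh_sinh_polar as [r er].
    rewrite <- W_base, <- (cexp_polar t (1 / 4) ht) in er.
    apply cexp_div in er. rewrite er. eexists.
    unfold Cminus, Cplus, Copp; simpl. f_equal. f_equal.
    unfold phase, arg_up; simpl. rewrite Rminus_0_r, Rminus_0_r, Rplus_0_r, Rplus_0_r. ring.
  - pose proof (W_step n) as e. pose proof (pos_INR n).
    rewrite <- (cexp_ln ((INR n + 1) * (INR n + 1 / 2))) in e by nra.
    rewrite (cexp_polar_conj _ _ ht), <- (cexp_polar _ (5 / 4 + INR n) ht), IH,
      <- !cexp_plus in e.
    apply cexp_div in e. rewrite e. eexists.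
    unfold Cminus, Cplus, Copp; simpl fst; simpl snd. f_equal. f_equal.
    unfold phase. rewrite tech5, S_INR. unfold arg_up.
    replace (5 / 4 + INR n) with (1 / 4 - 0 + (INR n + 1)) by lra.
    replace (3 / 4 - 0 + (INR n + 1)) with (3 / 4 + (INR n + 1)) by lra.
    ring.
Qed.

(** All follow from [cos >= 1/2] on [[0, x/2]]: the double-angle formula gives [sin x >= sin (x/2)],
    and the mean value theorem gives [sin (x/2) >= x/4]. *)
Lemma quarter_bounds (x : R) : 0 <= x <= PI / 2 ->
  1 / 2 <= cos (x / 2) /\ 0 <= sin (x / 2) <= sin x /\ x <= 4 * sin x.
Proof.
  intros hx. pose proof PI_RGT_0.
  assert (hc : forall y, 0 <= y <= x / 2 -> 1 / 2 <= cos y).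
  { intros y hy. rewrite <- cos_PI3. apply cos_decr_1; lra. }
  assert (c2 := hc (x / 2) ltac:(lra)).
  assert (s2 : 0 <= sin (x / 2)) by (apply sin_ge_0; lra).
  assert (es : sin x = 2 * sin (x / 2) * cos (x / 2)).
  { rewrite <- sin_2a. f_equal. field. }
  destruct (MVT_gen sin 0 (x / 2) cos) as [c [hc' e]].
  - intros y _. apply is_derive_Reals, derivable_pt_lim_sin.
  - intros y _. apply continuity_sin.
  - rewrite Rmin_left, Rmax_right in hc' by lra.
    specialize (hc c hc'). rewrite sin_0 in e.
    repeat split; nra.
Qed.

Lemma cosh_ge_1 (y : R) : 1 <= cosh y.
Proof.
  unfold cosh. pose proof (exp_ineq1_le y). pose proof (exp_ineq1_le (- y)). lra.
Qed.

Lemma sinh_le_mul_exp (y : R) : 0 <= y -> 0 <= sinh y <= y * exp y.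
Proof.
  intros hy. unfold sinh. pose proof (exp_pos y) as hp.
  assert (e : exp (- y) = exp y * exp (- (2 * y))).
  { rewrite <- exp_plus. f_equal. ring. }
  pose proof (exp_ineq1_le (- (2 * y))).
  assert (exp (- (2 * y)) <= 1).
  { rewrite <- exp_0. destruct hy as [hy | <-].
    - left. apply exp_increasing. lra.
    - right. f_equal. ring. }
  rewrite e. split; nra.
Qed.

Lemma wallis_le (n : nat) (f g : R -> R) :
  (forall x, continuous f x) -> (forall x, continuous g x) ->
  (forall x, 0 < x < PI / 2 -> f x <= g x) -> wallis n f <= wallis n g.
Proof.
  intros cf cg h. pose proof PI_RGT_0. apply RInt_le; [lra | | |].
  - eexists. now apply is_RInt_wallis.
  - eexists. now apply is_RInt_wallis.
  - intros x hx. apply Rmult_le_compat_l; [|now apply h].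
    apply pow_le, cos_ge_0; lra.
Qed.

Lemma wallis_scal (n : nat) (c : R) (f : R -> R) :
  (forall x, continuous f x) -> wallis n (fun x => c * f x) = c * wallis n f.
Proof.
  intros cf. apply is_RInt_unique.
  apply is_RInt_ext with (fun x => c * (cos x ^ n * f x)); [intros x _; apply Rminus_diag_uniq; ring|].
  apply (is_RInt_scal (fun x => cos x ^ n * f x)). now apply is_RInt_wallis.
Qed.

(** The classical Wallis recurrence, case [u = 1], [a = b = 0], after [sin^2 = 1 - cos^2]. It
    expresses that [cos^n] concentrates near 0 and supplies the decay in [W_arg_small]. *)
Lemma wallis_sin2 (n : nat) :
  INR (n + 2) * wallis n (fun x => sin x ^ 2) = wallis n (fun _ => 1).
Proof.
  assert (c1 : forall x : R, continuous (fun _ : R => 1) x)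
    by (intros; apply continuous_const).
  assert (e : wallis n (fun x => sin x ^ 2) =
              wallis n (fun _ => 1) - wallis (n + 2) (fun _ => 1)).
  { apply is_RInt_unique.
    apply is_RInt_ext with (fun x => cos x ^ n * 1 - cos x ^ (n + 2) * 1).
    { intros x _. rewrite pow_add. pose proof (sin2_cos2 x) as e. unfold Rsqr in e.
      replace (sin x ^ 2) with (1 - cos x * cos x) by (simpl; lra).
      apply Rminus_diag_uniq; ring. }
    apply (is_RInt_minus (fun x => cos x ^ n * 1) (fun x => cos x ^ (n + 2) * 1));
      now apply is_RInt_wallis. }
  pose proof (wallis_recurrence (fun _ => 1) (fun _ => 0) (fun _ => 1) 0 0 n) as r.
  rewrite e. clear e.
  set (N := INR (n + 2)) in *.
  assert (eN : INR (n + 1) = N - 1) by (unfold N; rewrite !plus_INR; simpl; lra).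
  assert (hN : 2 <= N).
  { unfold N. rewrite plus_INR. pose proof (pos_INR n). simpl. lra. }
  rewrite eN in r.
  assert (r' : N * (N * wallis (n + 2) (fun _ => 1)) = N * ((N - 1) * wallis n (fun _ => 1))).
  { rewrite <- Rmult_assoc, <- Rmult_assoc, <- r; [ring | | |exact c1|reflexivity].
    - intros x. apply (is_derive_const 1 x).
    - intros x. evar_last; [apply (is_derive_const 0 x)|]. unfold zero; simpl. ring. }
  apply Rmult_eq_reg_l in r'; lra.
Qed.

(** Pointwise [cv <= k sin^2] and [cu >= 1/2], so [wallis_sin2] bounds the ratio of imaginary to
    real part by a multiple of [1/(n+1)]. *)
Lemma W_arg_small (n : nat) :
  0 <= wallis (2 * n) cv <= 8 * t * exp (PI * t) / (INR n + 1) * wallis (2 * n) cu.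
Proof.
  assert (c1 : forall x : R, continuous (fun _ : R => 1) x)
    by (intros; apply continuous_const).
  assert (cs : forall x : R, continuous (fun x : R => sin x ^ 2) x).
  { intros x. apply (ex_derive_continuous (fun x => sin x ^ 2)). auto_derive. exact I. }
  assert (cc : forall (c : R) f, (forall x : R, continuous f x) ->
                forall x : R, continuous (fun x : R => c * f x) x).
  { intros c f hf x. apply (continuous_scal_r c f). apply hf. }
  (* From [sinh (2tx) <= 2tx e^(PI t)], [x <= 4 sin x] and [sin (x/2) <= sin x]. *)
  set (k := 8 * t * exp (PI * t)).
  pose proof (exp_pos (PI * t)) as hE. assert (hk : 0 < k) by (unfold k; nra).
  assert (bv : forall x, 0 < x < PI / 2 -> 0 <= cv x <= k * sin x ^ 2).
  { intros x hx. destruct (quarter_bounds x ltac:(lra)) as [_ [b1 b2]].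
    destruct (sinh_le_mul_exp (2 * t * x)) as [s1 s2]; [nra|].
    assert (exp (2 * t * x) <= exp (PI * t)).
    { left. apply exp_increasing. nra. }
    assert (sinh (2 * t * x) <= 2 * t * (4 * sin x) * exp (PI * t)).
    { eapply Rle_trans; [exact s2|]. apply Rmult_le_compat; try nra.
      left. apply exp_pos. }
    unfold cv, k. split; [nra|].
    replace (8 * t * exp (PI * t) * sin x ^ 2)
      with (sin x * (2 * t * (4 * sin x) * exp (PI * t))) by ring.
    apply Rmult_le_compat; lra. }
  assert (bu : wallis (2 * n) (fun x => 1 / 2 * 1) <= wallis (2 * n) cu).
  { apply wallis_le; [now apply cc | apply continuous_cu |].
    intros x hx. destruct (quarter_bounds x ltac:(lra)) as [b1 _].
    pose proof (cosh_ge_1 (2 * t * x)). unfold cu. nra. }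
  rewrite (wallis_scal _ (1 / 2) (fun _ => 1) c1) in bu.
  assert (b0 : wallis (2 * n) (fun x => 0 * 1) <= wallis (2 * n) cv).
  { apply wallis_le; [now apply cc | apply continuous_cv |].
    intros x hx. destruct (bv x hx). lra. }
  rewrite (wallis_scal _ 0 (fun _ => 1) c1) in b0.
  assert (b1 : wallis (2 * n) cv <= wallis (2 * n) (fun x => k * sin x ^ 2)).
  { apply wallis_le; [apply continuous_cv | now apply (cc k (fun x => sin x ^ 2)) |].
    intros x hx. now apply bv. }
  rewrite (wallis_scal _ k (fun x => sin x ^ 2) cs) in b1.
  pose proof (wallis_sin2 (2 * n)) as e.
  rewrite plus_INR, mult_INR in e. simpl INR in e. pose proof (pos_INR n).
  split; [lra|]. eapply Rle_trans; [exact b1|].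
  replace (k / (INR n + 1) * wallis (2 * n) cu)
    with (k * (wallis (2 * n) cu / (INR n + 1))) by (field; lra).
  apply Rmult_le_compat_l; [lra|].
  apply Rmult_le_reg_r with (INR n + 1); [lra|].
  replace (wallis (2 * n) cu / (INR n + 1) * (INR n + 1)) with (wallis (2 * n) cu)
    by (field; lra).
  lra.
Qed.

Lemma is_lim_seq_inv_succ (c : R) : is_lim_seq (fun n => c / (INR n + 1)) 0.
Proof.
  replace 0 with (c * 0) by ring.
  apply (is_lim_seq_mult' (fun _ => c)); [apply is_lim_seq_const|].
  apply is_lim_seq_ext with (fun n => / INR (S n)).
  - intros n. now rewrite S_INR.
  - apply (is_lim_seq_incr_1 (fun n => / INR n)).
    replace (Finite 0) with (Rbar_inv p_infty) by reflexivity.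
    apply is_lim_seq_inv; [apply is_lim_seq_INR | discriminate].
Qed.

Lemma arg_up_lim (c : R) : 1 / 2 <= c -> is_lim_seq (fun n => arg_up t (c + INR n)) 0.
Proof.
  intros hc.
  apply is_lim_seq_le_le with (fun _ => 0) (fun n => 2 * t / (INR n + 1));
    [|apply is_lim_seq_const | apply is_lim_seq_inv_succ].
  intros n. pose proof (pos_INR n). rewrite arg_up_inv by lra.
  assert (0 <= t / (c + INR n)) by (apply Rdiv_le_0_compat; lra).
  split.
  - rewrite <- atan_0. now apply atan_le.
  - eapply Rle_trans; [now apply atan_bounds|].
    replace (2 * t / (INR n + 1)) with (t * / ((INR n + 1) / 2)) by (field; lra).
    apply Rmult_le_compat_l; [lra|]. apply Rinv_le_contravar; lra.
Qed.

(** The argument of [W n] tends to [alpha - l] by [W_polar], while its sine tends to 0 by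
    [W_arg_small]. Since [alpha - l] lies in [(-PI, PI)], it is 0. *)
Lemma phase_0_lim : is_lim_seq (phase t 0) alpha.
Proof.
  destruct (phase_converges t 0 ht) as [l hl].
  replace alpha with l; [exact hl|].
  pose proof (phase_lim_range t 0 l ht hl) as [l0 l1].
  assert (hd : alpha - l = 0); [|lra].
  pose proof PI_RGT_0 as hPI.
  apply sin_eq_0_small.
  { pose proof (exp_pos (- (2 * PI * t))) as hp.
    assert (0 < atan (exp (- (2 * PI * t)))).
    { rewrite <- atan_0. now apply atan_increasing. }
    assert (atan (exp (- (2 * PI * t))) <= PI / 4).
    { rewrite <- atan_1. apply atan_le. rewrite <- exp_0. left.
      apply exp_increasing. nra. }
    unfold alpha. lra. }
  set (d := fun n => alpha - phase t 0 n - arg_up t (3 / 4 + INR n)).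
  assert (hdl : is_lim_seq d (alpha - l)).
  { unfold d. replace (alpha - l) with (alpha - l - 0) by ring.
    apply is_lim_seq_minus'; [|apply arg_up_lim; lra].
    apply is_lim_seq_minus'; [apply is_lim_seq_const | exact hl]. }
  assert (hs := is_lim_seq_continuous sin _ _
           (derivable_continuous_pt _ _ (derivable_pt_sin (alpha - l))) hdl).
  assert (bd : forall n, Rabs (sin (d n)) <= 8 * t * exp (PI * t) / (INR n + 1)).
  { intros n. destruct (W_polar n) as [r er]. fold (d n) in er.
    pose proof (f_equal Re er) as e1. pose proof (f_equal Im er) as e2.
    unfold W, cexp in e1, e2. cbn [Re Im fst snd] in e1, e2.
    pose proof (W_arg_small n) as [w1 w2]. rewrite e1 in w2.
    set (k := 8 * t * exp (PI * t) / (INR n + 1)) in *.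
    pose proof (exp_pos r) as hr. pose proof (COS_bound (d n)).
    assert (hk : 0 <= k).
    { unfold k. pose proof (pos_INR n). pose proof (exp_pos (PI * t)).
      apply Rdiv_le_0_compat; nra. }
    apply Rmult_le_reg_l with (exp r); [exact hr|].
    rewrite <- (Rabs_pos_eq (exp r)) at 1 by lra.
    rewrite <- Rabs_mult, <- e2, Rabs_Ropp, Rabs_pos_eq by exact w1.
    assert (exp r * cos (d n) <= exp r * 1) by (apply Rmult_le_compat_l; lra).
    nra. }
  assert (hz : is_lim_seq (fun n => sin (d n)) 0).
  { apply is_lim_seq_abs_0.
    apply is_lim_seq_le_le with (fun _ => 0) (fun n => 8 * t * exp (PI * t) / (INR n + 1)).
    - intros n. split; [apply Rabs_pos | apply bd].
    - apply is_lim_seq_const.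
    - apply is_lim_seq_inv_succ. }
  apply is_lim_seq_unique in hs, hz. rewrite hs in hz. now injection hz.
Qed.

End QuarterProduct.

(** * Dependence of the phase on s *)

(* Compares the k-th term of [phase t c] with half of a telescoping term. *)
Definition midpoint_defect (t : R) (k : nat) (c : R) : R :=
  atan ((3 / 4 - c + INR k) / t) - atan ((1 / 4 - c + INR k) / t)
  - (atan ((1 - c + INR k) / t) - atan ((- c + INR k) / t)) / 2.

(** [t / (t^2 + x^2)] is the [x]-derivative of [atan (x / t)]. Each difference is a multiple of
    [t y] over [Q1] or [Q2], and the weights leave [t y (Q1 - Q2) / (Q1 Q2)], where the [S^2] terms
    of [Q1 - Q2] cancel. *)
Lemma cauchy_kernel_defect (t y : R) : 1 <= t -> 0 <= y ->
  Rabs (t / (t ^ 2 + (y + 1 / 4) ^ 2) - t / (t ^ 2 + (y - 1 / 4) ^ 2)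
        - (t / (t ^ 2 + (y + 1 / 2) ^ 2) - t / (t ^ 2 + (y - 1 / 2) ^ 2)) / 2)
  <= / (t ^ 2 * (1 + y ^ 2)).
Proof.
  intros ht hy. set (S := t ^ 2 + y ^ 2).
  assert (hS : 1 + y ^ 2 <= S) by (unfold S; nra).
  assert (hS' : t ^ 2 <= S) by (unfold S; nra).
  assert (hty : 0 <= t * y <= S / 2).
  { split; [nra|]. unfold S. pose proof (pow2_ge_0 (t - y)). lra. }
  set (Q1 := (t ^ 2 + (y + 1 / 4) ^ 2) * (t ^ 2 + (y - 1 / 4) ^ 2)).
  set (Q2 := (t ^ 2 + (y + 1 / 2) ^ 2) * (t ^ 2 + (y - 1 / 2) ^ 2)).
  assert (h1 : S ^ 2 / 2 <= Q1).
  { replace Q1 with ((S + 1 / 16) ^ 2 - y ^ 2 / 4) by (unfold Q1, S; field). nra. }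
  assert (h2 : S ^ 2 / 2 <= Q2).
  { replace Q2 with ((S + 1 / 4) ^ 2 - y ^ 2) by (unfold Q2, S; field). nra. }
  set (num := t * y * (3 / 8 * (t ^ 2 - y ^ 2) + 15 / 256)).
  assert (hn : Rabs num <= S ^ 2 / 4).
  { unfold num. rewrite Rabs_mult, (Rabs_pos_eq (t * y)) by lra.
    assert (Rabs (3 / 8 * (t ^ 2 - y ^ 2) + 15 / 256) <= S / 2).
    { apply Rabs_le. pose proof (pow2_ge_0 y). unfold S in *. split; nra. }
    pose proof (Rabs_pos (3 / 8 * (t ^ 2 - y ^ 2) + 15 / 256)). nra. }
  assert (p1 : 0 < Q1) by nra. assert (p2 : 0 < Q2) by nra.
  match goal with |- Rabs ?e <= _ => replace e with (- (num * / (Q1 * Q2))) end.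
  2: { unfold num, Q1, Q2. field. repeat split; nra. }
  assert (p3 : 0 < / (Q1 * Q2)) by now apply Rinv_0_lt_compat, Rmult_lt_0_compat.
  clearbody num Q1 Q2.
  rewrite Rabs_Ropp, Rabs_mult, (Rabs_pos_eq (/ _)) by lra.
  assert (hS0 : 0 < S ^ 2) by nra.
  assert (iQ : / (Q1 * Q2) <= / (S ^ 2 / 2 * (S ^ 2 / 2))).
  { apply Rinv_le_contravar; nra. }
  apply Rle_trans with (S ^ 2 / 4 * / (S ^ 2 / 2 * (S ^ 2 / 2))).
  { apply Rmult_le_compat; try lra. apply Rabs_pos. }
  replace (S ^ 2 / 4 * / (S ^ 2 / 2 * (S ^ 2 / 2))) with (/ S ^ 2) by (field; nra).
  apply Rinv_le_contravar; nra.
Qed.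

Lemma midpoint_defect_diff (t s : R) (k : nat) : 1 <= t -> 0 < s < 1 / 2 ->
  Rabs (midpoint_defect t k s - midpoint_defect t k 0)
  <= 4 * s / t ^ 2 * (/ (INR k + 1) - / (INR k + 2)).
Proof.
  intros ht hs. pose proof (pos_INR k) as hk.
  set (g := fun x => t / (t ^ 2 + x ^ 2)).
  set (D := fun c => - (g (3 / 4 - c + INR k) - g (1 / 4 - c + INR k)
              - (g (1 - c + INR k) - g (- c + INR k)) / 2)).
  assert (der : forall c, is_derive (midpoint_defect t k) c (D c)).
  { intros c. unfold midpoint_defect, D, g. auto_derive; [exact I|].
    unfold Rsqr. field. repeat split; try lra;
      (apply Rgt_not_eq, Rplus_lt_le_0_compat; [nra | apply pow2_ge_0]). }
  destruct (MVT_gen (midpoint_defect t k) 0 s D) as [c [hc e]].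
  - intros; apply der.
  - intros x _. apply derivable_continuous_pt. exists (D x). apply is_derive_Reals, der.
  - rewrite Rmin_left, Rmax_right in hc by lra. rewrite e, Rabs_mult, Rminus_0_r.
    rewrite (Rabs_pos_eq s) by lra.
    assert (b : Rabs (D c) <= 4 / t ^ 2 * (/ (INR k + 1) - / (INR k + 2))).
    { unfold D. rewrite Rabs_Ropp.
      (* The common midpoint of the two pairs of points; [c <= s < 1/2] puts it to the right of
         [k]. *)
      set (y := INR k - c + 1 / 2). assert (hy : INR k <= y) by (unfold y; lra).
      pose proof (cauchy_kernel_defect t y ht ltac:(lra)) as b. unfold g.
      replace (3 / 4 - c + INR k) with (y + 1 / 4) by (unfold y; lra).
      replace (1 / 4 - c + INR k) with (y - 1 / 4) by (unfold y; lra).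
      replace (1 - c + INR k) with (y + 1 / 2) by (unfold y; lra).
      replace (- c + INR k) with (y - 1 / 2) by (unfold y; lra).
      eapply Rle_trans; [exact b|].
      (* Bounds [1/(1 + y^2)] by [4/((k+1)(k+2))], chosen because it telescopes when summed over
         [k]. *)
      replace (4 / t ^ 2 * (/ (INR k + 1) - / (INR k + 2)))
        with (/ (t ^ 2 * ((INR k + 1) * (INR k + 2) / 4))) by (field; lra).
      assert (t2 : 0 < t ^ 2) by nra.
      apply Rinv_le_contravar.
      - apply Rmult_lt_0_compat; nra.
      - apply Rmult_le_compat_l; [lra|].
        assert (INR k ^ 2 <= y ^ 2) by (apply pow_incr; lra).
        pose proof (pow2_ge_0 (INR k - 1 / 2)). lra. }
    replace (4 * s / t ^ 2 * (/ (INR k + 1) - / (INR k + 2)))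
      with (4 / t ^ 2 * (/ (INR k + 1) - / (INR k + 2)) * s) by (field; lra).
    apply Rmult_le_compat_r; lra.
Qed.

(** The half-telescoping sum contributes the main term [atan (s / t) / 2] from its lower end and two
    vanishing arguments from its upper end; the defects contribute the error. *)
Lemma phase_diff_bound (t s : R) (n : nat) : 1 <= t -> 0 < s < 1 / 2 ->
  Rabs (phase t s n - phase t 0 n
        - (arg_up t (1 + INR n) - arg_up t (1 - s + INR n) + atan (s / t)) / 2)
  <= 4 * s / t ^ 2.
Proof.
  intros ht hs.
  assert (tel : forall c, phase t c n = sum_f_R0 (fun k => midpoint_defect t k c) n
                 + (atan ((1 - c + INR n) / t) - atan (- c / t)) / 2).
  { intros c. induction n as [|n IH].
    - unfold phase, midpoint_defect; simpl. rewrite !Rplus_0_r. field.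
    - unfold phase in *. rewrite !tech5, IH. unfold midpoint_defect at 3.
      replace (- c + INR (S n)) with (1 - c + INR n) by (rewrite S_INR; ring).
      field. }
  assert (e : phase t s n - phase t 0 n
        - (arg_up t (1 + INR n) - arg_up t (1 - s + INR n) + atan (s / t)) / 2 =
        sum_f_R0 (fun k => midpoint_defect t k s - midpoint_defect t k 0) n).
  { rewrite !tel, minus_sum. unfold arg_up.
    replace (- s / t) with (- (s / t)) by (field; lra).
    replace (- 0 / t) with 0 by (field; lra).
    replace (1 - 0 + INR n) with (1 + INR n) by ring.
    rewrite atan_opp, atan_0. field. }
  rewrite e.
  apply Rle_trans with (4 * s / t ^ 2 * (1 - / (INR n + 2))).
  - clear tel e. induction n as [|n IH].
    + simpl sum_f_R0. eapply Rle_trans; [now apply midpoint_defect_diff|].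
      simpl. right. f_equal. field.
    + rewrite tech5. eapply Rle_trans; [apply Rabs_triang|].
      pose proof (midpoint_defect_diff t s (S n) ht hs) as b.
      rewrite S_INR in b |- *. pose proof (pos_INR n).
      replace (INR n + 1 + 1) with (INR n + 2) in b by ring.
      lra.
  - assert (0 <= 4 * s / t ^ 2) by (apply Rdiv_le_0_compat; nra).
    assert (0 < / (INR n + 2)).
    { apply Rinv_0_lt_compat. pose proof (pos_INR n). lra. }
    nra.
Qed.

(** * Asymptotics as h tends to 0 *)

Lemma phase_equation_bound (t s : R) : 1 <= t -> 0 < s < 1 / 2 ->
  is_lim_seq (phase t s) (PI / 4) ->
  Rabs (atan (exp (- (2 * PI * t))) - atan (s / t) / 2) <= 4 * s / t ^ 2.
Proof.
  intros ht hs hl.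
  pose proof (phase_0_lim t ltac:(lra)) as h0.
  set (l := atan (exp (- (2 * PI * t))) - atan (s / t) / 2).
  assert (lim : is_lim_seq (fun n => phase t s n - phase t 0 n
     - (arg_up t (1 + INR n) - arg_up t (1 - s + INR n) + atan (s / t)) / 2) l).
  { replace l with (PI / 4 - (PI / 4 - atan (exp (- (2 * PI * t))))
                    - (0 - 0 + atan (s / t)) * / 2) by (unfold l; field).
    apply is_lim_seq_minus'.
    - now apply is_lim_seq_minus'.
    - apply (is_lim_seq_mult' _ (fun _ => / 2)); [|apply is_lim_seq_const].
      apply is_lim_seq_plus'; [|apply is_lim_seq_const].
      apply is_lim_seq_minus'; apply arg_up_lim; lra. }
  apply Rabs_le.
  refine (is_lim_seq_bounds _ l _ _ _ lim).
  intros n. apply Rabs_le_between. now apply phase_diff_bound.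
Qed.

Lemma small_h (h sig : R) :
  0 < h < / 80 -> 0 < sig < 1 -> is_lim_seq (phase (/ (2 * h)) (sig / 2)) (PI / 4) ->
  Rabs (sig / (2 * exp (- PI / h) / h) - 1) <= 62 * h.
Proof.
  intros hh hsig hl. set (t := / (2 * h)) in *. set (s := sig / 2) in *.
  assert (ht : 40 <= t).
  { unfold t. replace 40 with (/ (2 * / 80)) by field. apply Rinv_le_contravar; lra. }
  assert (hs : 0 < s < 1 / 2) by (unfold s; lra).
  pose proof (phase_equation_bound t s ltac:(lra) hs hl) as b.
  set (q := exp (- (2 * PI * t))) in *.
  assert (hq : 0 < q) by apply exp_pos.
  assert (hqt : q <= / t).
  { unfold q. rewrite exp_Ropp. apply Rinv_le_contravar; [lra|].
    pose proof (exp_ineq1_le (2 * PI * t)). pose proof PI2_1. nra. }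
  assert (ht1 : 0 < / t <= / 40).
  { split; [apply Rinv_0_lt_compat; lra | apply Rinv_le_contravar; lra]. }
  pose proof (atan_bounds q ltac:(lra)) as a1.
  assert (hst : 0 <= s / t) by (apply Rdiv_le_0_compat; lra).
  pose proof (atan_bounds (s / t) hst) as a2.
  (* This is the ratio of [sigma] to its claimed leading term, since [1/h = 2t]. *)
  set (y := s / (2 * t * q)).
  assert (es : s = 2 * t * q * y) by (unfold y; field; lra).
  assert (hy : 0 < y) by (unfold y; apply Rdiv_lt_0_compat; nra).
  assert (et : s / t = 2 * q * y) by (rewrite es; field; lra).
  assert (e1 : 4 * s / t ^ 2 = q * (8 * y * / t)) by (rewrite es; field; lra).
  assert (e2 : (s / t) ^ 2 <= q * (2 * y * / t)).
  { replace (q * (2 * y * / t)) with (s / t * / t) by (rewrite et; ring).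
    replace ((s / t) ^ 2) with (s / t * / t * s) by (field; lra).
    assert (0 <= s / t * / t) by nra. nra. }
  rewrite e1 in b. apply Rabs_le_between in b.
  (* The phase error costs [8 q y / t], linearising [atan (s / t)] at most [2 q y / t], and
     linearising [atan q] at most [q^2]. *)
  assert (u : Rabs (q * (y - 1)) <= q * (10 * y * / t + q)).
  { apply Rabs_le. split; nra. }
  rewrite Rabs_mult, (Rabs_pos_eq q) in u by lra.
  apply Rmult_le_reg_l in u; [|exact hq].
  (* Bootstrap: with [t >= 40] the error [10 y / t + q] is at most [(10 y + 1) / 40], which bounds
     [y]; the error is then at most [31 / t = 62 h]. *)
  assert (hy3 : y <= 3).
  { apply Rabs_le_between in u. nra. }
  replace (sig / (2 * exp (- PI / h) / h)) with y.
  - eapply Rle_trans; [exact u|].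
    replace (62 * h) with (31 * / t) by (unfold t; field; lra). nra.
  - assert (eq : exp (- PI / h) = q).
    { unfold q, t. f_equal. field. lra. }
    rewrite eq. unfold y, s, t. field. lra.
Qed.

Theorem theorem1p4 (sigma : R -> R) :
  (forall h, 0 < h ->
     0 < sigma h < 1 /\
     Im (A_fun (lam_of h (sigma h))) = 0 /\
     0 < Re (A_fun (lam_of h (sigma h)))) ->
  (exists K delta, 0 < delta /\
     forall h, 0 < h < delta ->
       Rabs (sigma h / (2 * exp (- PI / h) / h) - 1) <= K * h) /\
  (exists K M, 0 < M /\
     forall h, M < h ->
       Rabs (sigma h - (1/2 - / h)) <= K / h ^ 2).
Proof.
  intros H. split.
  - exists 62, (/ 80). split; [lra|]. intros h hh.
    destruct (H h ltac:(lra)) as [hs [hI _]].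
    apply small_h; [exact hh | exact hs |].
    apply phase_of_real_A; [lra | exact hs | exact hI].
  - exists 16, 50. split; [lra|]. intros h hh.
    destruct (H h ltac:(lra)) as [hs [hI _]].
    apply large_h; [lra | exact hs |].
    apply phase_of_real_A; [lra | exact hs | exact hI].
Qed.
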